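(* For a triangulated structure in the plane with nondegenerate triangles, let $\mathcal P$ be the union of the closed star neighborhoods of all interior vertices, and let $$\sigma(L)=\sum_{ij}\sigma(E_{ij})\,L_{ij}$$ be the sum of the wagon wheel functionals of all interior vertices. Then $\sigma(E_{ij})=0$ except for edges $E_{ij}$ that either touch the boundary of $\mathcal P$ or have both endpoints one link away from the boundary of $\mathcal P$. For such edges, $\sigma(E_{ij})$ is the sum of the coefficients of $L_{ij}$ in all wagon wheel functionals whose star neighborhoods contain $E_{ij}$ as a radial or circumferential edge. Explicitly, for an edge $E_{02}=V_0V_2$ with adjacent triangles $V_0V_2V_1$ and $V_0V_2V_3$ (the latter possibly absent when $V_0V_2$ lies on the boundary of the domain, in which case $V_3$ is counted as non-interior), put $\ell=|V_0V_2|$, $\alpha_1=\angle V_1V_0V_2$, $\alpha_2=\angle V_2V_0V_3$, $\beta_1=\angle V_0V_2V_1$, $\gamma_1=\angle V_0V_2V_3$, $h_1=\ell\sin\beta_1$, $h_2=\ell\sin\gamma_1$, $h_5=\ell\sin\alpha_1$, $h_6=\ell\sin\alpha_2$, and let $h_3$, $h_4$ be the distances of $V_1$, $V_3$ respectively from the line $V_0V_2$. Then: (1) only $V_1$ interior (boundary edge): $\sigma(E_{02})=\frac1{h_3}$; (2) only $V_0$ interior (unique incoming edge): $\sigma(E_{02})=-\frac{\cos\beta_1}{h_1}-\frac{\cos\gamma_1}{h_2}$; (3) exactly $V_1,V_3$ interior (isthmus edge): $\sigma(E_{02})=\frac1{h_3}+\frac1{h_4}$; (4) exactly $V_0,V_1$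 interior (extreme of multiple incoming edges): $\sigma(E_{02})=\frac{\cos\alpha_1}{h_5}-\frac{\cos\gamma_1}{h_2}$; (5) exactly $V_0,V_2$ interior (interior spine edge): $\sigma(E_{02})=-\frac1{h_3}-\frac1{h_4}$; (6) exactly $V_0,V_1,V_3$ interior (middle of multiple incoming edges): $\sigma(E_{02})=\frac{\cos\alpha_1}{h_5}+\frac{\cos\alpha_2}{h_6}$; (7) exactly $V_0,V_1,V_2$ interior (boundary parallel edge): $\sigma(E_{02})=-\frac1{h_4}$.
   Context: A triangulated structure consists of the vertices and (straight) edges of a piecewise linear triangulation of a planar domain: a tiling by finitely many non-overlapping closed triangles, meeting only in a common vertex or along a whole common edge, whose union is the closure of the domain. A vertex is interior if it is an interior point of this union. The closed star neighborhood of a vertex is the union of the closed triangles containing it. An edge touches the boundary of $\mathcal P$ if at least one of its endpoints is on the boundary of $\mathcal P$; a vertex is one link away from the boundary if it is joined by an edge to a vertex on the boundary of $\mathcal P$. Wagon wheel functional: for an interior vertex $W_0$ with adjacent vertices $W_1,\dots,W_n$ in cyclic order (indices mod $n$), it is the linear functional of the edge elongations $L$ $$\sum_{i=1}^n\frac{L_{W_iW_{i+1}}}{h_i}-\sum_{i=1}^n\left\{\frac{\cos\beta_i}{h_i}+\frac{\cos\gamma_i}{h_{i-1}}\right\}L_{W_0W_i},$$ where (locally to this formula) $\beta_i=\angle W_0W_iW_{i+1}$, $\gamma_i=\angle W_0W_iW_{i-1}$, and $h_i$ is the distance from $W_0$ to the line $W_iW_{i+1}$. The edges $W_0W_i$ are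 radial and the edges $W_iW_{i+1}$ circumferential for the star of $W_0$. *)

(* Defs.v *)
From HB Require Import structures.
From mathcomp Require Import all_boot all_order all_algebra.
From mathcomp Require Import all_classical all_reals all_analysis.
Import Order.TTheory GRing.Theory Num.Theory numFieldNormedType.Exports.

Set Implicit Arguments.
Unset Strict Implicit.
Unset Printing Implicit Defensive.

Local Open Scope ring_scope.

Section PlaneGeometry.
Variable R : realType.
Implicit Types u v A B C : 'rV[R]_2.

Definition dot u v : R := \sum_(i < 2) u 0 i * v 0 i.

(* The library norm on row vectors is the sup norm; it induces the same
   topology, but lengths must be Euclidean. *)
Definition enorm u : R := Num.sqrt (dot u u).

Definition cross u v : R := u 0 0 * v 0 1 - u 0 1 * v 0 0.

(* The angle ABC at the vertex B, in [0, pi]. *)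
Definition angle A B C : R :=
  acos (dot (A - B) (C - B) / (enorm (A - B) * enorm (C - B))).

(* Distance from A to the line BC. *)
Definition line_dist A B C : R :=
  inf [set enorm (A - (B + t *: (C - B))) | t in [set: R]]%classic.

(* Counterclockwise argument of u != 0 from the first axis, in [0, 2 pi). *)
Definition polar_angle u : R :=
  let a := acos (u 0 0 / enorm u) in
  if 0 <= u 0 1 then a else 2 * pi - a.

Definition boundary (X : set 'rV[R]_2) : set 'rV[R]_2 :=
  (closure X `\` interior X)%classic.

End PlaneGeometry.

Section Hull.
Variables (R : realType) (V : finType) (pos : V -> 'rV[R]_2).

(* Convex hull of the points pos v, v \in t. *)
Definition hull (t : {set V}) : set 'rV[R]_2 :=
  [set \sum_(v in t) w v *: pos v
     | w in [set w : V -> R | (forall v, 0 <= w v) /\ \sum_(v in t) w v = 1]]%classic.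

End Hull.

Definition segm (V : finType) (a b : V) : {set V} := [set a; b]%SET.
Definition trig (V : finType) (a b c : V) : {set V} := [set a; b; c]%SET.

Record triangulated_structure (R : realType) (V : finType) := TriangulatedStructure {
  pos : V -> 'rV[R]_2;
  tris : {set {set V}};
  pos_inj : injective pos;
  vertexP : forall v, exists2 t, t \in tris & v \in t;
  tri_nondegenerate : forall t, t \in tris ->
    exists a b c, t = trig a b c /\ cross (pos b - pos a) (pos c - pos a) != 0;
  (* Two distinct triangles share at most two vertices, so the right-hand side
     is empty, a common vertex, or a whole common edge. *)
  tri_meet : forall s t, s \in tris -> t \in tris -> s != t ->
    (hull pos s `&` hull pos t = hull pos (s :&: t)%SET)%classic;
  tri_domain : exists D : set 'rV[R]_2,
    [/\ (D !=set0)%classic, open D, connected D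
      & closure D = (\bigcup_(t in [set` tris]) hull pos t)%classic]
}.

Section TriangulatedStructure.
Variables (R : realType) (V : finType) (S : triangulated_structure R V).
Implicit Types (v a b : V) (e : {set V}).
Local Notation pos := (pos S).

Definition carrier : set 'rV[R]_2 :=
  (\bigcup_(t in [set` tris S]) hull pos t)%classic.

Definition edges : {set {set V}} :=
  [set e : {set V} | (#|e| == 2) && [exists t in tris S, e \subset t]]%SET.

Definition adjacent v a : bool := segm v a \in edges.

Definition is_interior v : bool := `[< interior carrier (pos v) >].

Definition closed_star v : set 'rV[R]_2 :=
  (\bigcup_(t in [set t : {set V} | t \in tris S /\ hull pos t (pos v)])
     hull pos t)%classic.

Definition region : set 'rV[R]_2 :=
  (\bigcup_(v in [set v : V | is_interior v]) closed_star v)%classic.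

Definition on_boundary v : Prop := boundary region (pos v).

Definition touches_boundary e : Prop := exists2 v, v \in e & on_boundary v.

Definition one_link_away v : Prop := exists2 a, adjacent v a & on_boundary a.

(* The neighbors W_1, ..., W_n of v in counterclockwise cyclic order; the
   cyclic successor and predecessor of a in s are next s a and prev s a. *)
Definition spokes v : seq V :=
  sort (fun a b => polar_angle (pos a - pos v) <= polar_angle (pos b - pos v))
       (enum (adjacent v)).

Definition radial v e : bool := has (fun a => e == segm v a) (spokes v).

Definition circumferential v e : bool :=
  has (fun a => e == segm a (next (spokes v) a)) (spokes v).

(* Elongations are functions of the edge, seen as its set of endpoints; only
   the values on edges matter. *)
Definition functional : Type := ({set V} -> R) -> R.

Definition wagon_wheel v : functional := fun L =>
  let s := spokes v in
  let h a := line_dist (pos v) (pos a) (pos (next s a)) in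
  let beta a := angle (pos v) (pos a) (pos (next s a)) in
  let gamma a := angle (pos v) (pos a) (pos (prev s a)) in
  \sum_(a <- s) L (segm a (next s a)) / h a
  - \sum_(a <- s) (cos (beta a) / h a + cos (gamma a) / h (prev s a))
                   * L (segm v a).

Definition sigma : functional := fun L =>
  \sum_(v | is_interior v) wagon_wheel v L.

(* Coefficient of L_e in a linear functional: its value on the elongation
   that is 1 on e and 0 elsewhere. *)
Definition coeff (F : functional) e : R := F (fun e' => (e' == e)%:R).

End TriangulatedStructure.

(* Main.v *)
(* At an interior vertex v, sorting the neighbors by polar angle makes
   consecutive ones span the triangles of the star: a triangle v a b leaves no
   neighbor strictly inside its cone, and a neighborhood of v is covered, so
   each edge va has a triangle on either side. Hence L_ab occurs in the wagon
   wheel of v only if v is a or b (radial) or v a b is a triangle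
   (circumferential), i.e. for at most four vertices. The coefficients reduce
   to each other by (cot A + cot B) / |AB| = 1 / h, h the height on AB; in
   particular all four cancel when all four vertices are interior, and a
   nonexceptional edge has either all four interior or none. *)
Require Import Defs.
From HB Require Import structures.
From mathcomp Require Import all_boot all_order all_algebra.
From mathcomp Require Import all_classical all_reals all_analysis.
From mathcomp Require Import ring lra.
Import Order.TTheory GRing.Theory Num.Theory numFieldNormedType.Exports.

Set Implicit Arguments.
Unset Strict Implicit.
Unset Printing Implicit Defensive.

Local Open Scope ring_scope.

(** * Plane geometry *)

Section Plane.
Variable R : realType.
Implicit Types (u v w z A B C : 'rV[R]_2) (k : R).

Lemma dotE u v : dot u v = u 0 0 * v 0 0 + u 0 1 * v 0 1.
Proof.
rewrite /dot !big_ord_recl big_ord0 addr0.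
by congr (u _ _ * v _ _ + u _ _ * v _ _); apply/val_inj.
Qed.

Lemma eq_plane u v : u 0 0 = v 0 0 -> u 0 1 = v 0 1 -> u = v.
Proof.
move=> e0 e1; apply/rowP => -[[|[|//]] i2].
  by have -> : Ordinal i2 = 0 by apply/val_inj.
by have -> : Ordinal i2 = 1 by apply/val_inj.
Qed.

Lemma enorm_ge0 u : 0 <= enorm u.
Proof. exact: sqrtr_ge0. Qed.

Lemma enorm_sq u : enorm u ^+ 2 = dot u u.
Proof. by rewrite sqr_sqrtr // dotE; nra. Qed.

Lemma enorm_gt0 u : (0 < enorm u) = (u != 0).
Proof.
rewrite lt_neqAle enorm_ge0 andbT eq_sym; congr negb; apply/eqP/eqP => [u0|->]; last first.
  by rewrite /enorm dotE !mxE mul0r addr0 sqrtr0.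
have := enorm_sq u; rewrite u0 dotE expr0n /= => e.
by apply: eq_plane; rewrite mxE; nra.
Qed.

Lemma enormN u : enorm (- u) = enorm u.
Proof. by rewrite /enorm !dotE !mxE !mulrNN. Qed.

Lemma crossC u v : cross v u = - cross u v.
Proof. by rewrite /cross; ring. Qed.

Lemma lagrange u v : (enorm u * enorm v) ^+ 2 = dot u v ^+ 2 + cross u v ^+ 2.
Proof. by rewrite exprMn !enorm_sq !dotE /cross; ring. Qed.

Lemma cross_neq0 u v : cross u v != 0 -> (u != 0) && (v != 0).
Proof.
by apply: contraNT; rewrite negb_and !negbK /cross => /orP[] /eqP ->; rewrite !mxE; apply/eqP; ring.
Qed.

(** The cross product with [C - B] is constant along the line. By [lagrange] it bounds the distance
    to every point of the line from below, with equality where the dot product vanishes. *)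
Lemma line_distE A B C : C != B ->
  line_dist A B C = `|cross (A - B) (C - B)| / enorm (C - B).
Proof.
rewrite -subr_eq0 -enorm_gt0 => n0; set n := enorm _ in n0 *.
rewrite /line_dist; set E := (X in inf X).
have crossE t : cross (A - (B + t *: (C - B))) (C - B) = cross (A - B) (C - B).
  by rewrite /cross !mxE; ring.
have lbE : lbound E (`|cross (A - B) (C - B)| / n).
  move=> _ [t _ <-]; rewrite ler_pdivrMr // -(crossE t).
  rewrite -(@ler_pXn2r _ 2) // ?nnegrE ?mulr_ge0 ?enorm_ge0 ?(ltW n0)//.
  by rewrite lagrange real_normK ?num_real// lerDr sqr_ge0.
(* [t0] is the parameter of the foot of the perpendicular from [A], where the infimum is
   attained. *)
set t0 := dot (A - B) (C - B) / n ^+ 2.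
have Et0 : E (`|cross (A - B) (C - B)| / n).
  exists t0 => //; apply/eqP.
  rewrite -(@eqrXn2 _ 2) ?enorm_ge0 ?divr_ge0 ?(ltW n0)//.
  rewrite exprMn exprVn real_normK ?num_real// -(crossE t0).
  have d0 : dot (A - (B + t0 *: (C - B))) (C - B) = 0.
    transitivity (dot (A - B) (C - B) - t0 * n ^+ 2).
      by rewrite /n enorm_sq !dotE !mxE; ring.
    by rewrite /t0 divfK ?subrr// expf_eq0 /= gt_eqF.
  have := lagrange (A - (B + t0 *: (C - B))) (C - B).
  rewrite d0 expr0n add0r exprMn => <-.
  by rewrite mulfK// expf_eq0 /= gt_eqF.
apply/eqP; rewrite eq_le; apply/andP; split.
  by apply: ge_inf => //; exists (`|cross (A - B) (C - B)| / n).
by apply: lb_le_inf => //; exists (`|cross (A - B) (C - B)| / n).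
Qed.

Lemma line_distC A B C : C != B -> line_dist A C B = line_dist A B C.
Proof.
move=> CB; rewrite !line_distE // 1?eq_sym //.
rewrite -(enormN (C - B)) opprB; congr (_ / _).
by rewrite -normrN; congr `| _ |; rewrite /cross !mxE; ring.
Qed.

Lemma angleC A B C : angle C B A = angle A B C.
Proof.
rewrite /angle [enorm (C - B) * _]mulrC !dotE.
by congr (acos (_ / _)); rewrite mulrC [X in _ + X]mulrC.
Qed.

Lemma cos_bound u v : u != 0 -> v != 0 ->
  -1 <= dot u v / (enorm u * enorm v) <= 1.
Proof.
rewrite -!enorm_gt0 => u0 v0; have uv0 := mulr_gt0 u0 v0.
rewrite ler_pdivlMr// ler_pdivrMr// mulN1r mul1r -ler_norml.
rewrite -(@ler_pXn2r _ 2) ?nnegrE ?(ltW uv0)//.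
by rewrite lagrange real_normK ?num_real// lerDl sqr_ge0.
Qed.

Lemma cos_angle A B C : A != B -> C != B ->
  cos (angle A B C) = dot (A - B) (C - B) / (enorm (A - B) * enorm (C - B)).
Proof.
by rewrite -(subr_eq0 A) -(subr_eq0 C) => AB CB; rewrite acosK// in_itv /= cos_bound.
Qed.

Lemma sin_angle A B C : A != B -> C != B ->
  sin (angle A B C) = `|cross (A - B) (C - B)| / (enorm (A - B) * enorm (C - B)).
Proof.
rewrite -(subr_eq0 A) -(subr_eq0 C) => AB CB; rewrite sin_acos ?cos_bound//.
have uv0 : 0 < enorm (A - B) * enorm (C - B) by rewrite mulr_gt0 ?enorm_gt0.
apply/eqP; rewrite -(@eqrXn2 _ 2) ?sqrtr_ge0 ?divr_ge0 ?(ltW uv0)//.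
rewrite sqr_sqrtr; last first.
  rewrite subr_ge0 -real_normK ?num_real// expr_le1 // ler_norml.
  exact: cos_bound.
rewrite !exprMn exprVn lagrange real_normK ?num_real//.
have : dot (A - B) (C - B) ^+ 2 + cross (A - B) (C - B) ^+ 2 != 0.
  by rewrite -lagrange expf_eq0 /= gt_eqF.
by move=> ?; apply/eqP; field.
Qed.

Lemma enorm_sin_angle A B C : A != B -> C != B ->
  enorm (A - B) * sin (angle A B C) = line_dist A B C.
Proof.
move=> AB CB; rewrite sin_angle// line_distE//.
by move: AB CB; rewrite -(subr_eq0 A) -(subr_eq0 C) -!enorm_gt0 => ? ?; field; rewrite !gt_eqF.
Qed.

(** Either side is the cotangent of the angle at [B] divided by |AB|; the right one is free of
    [acos]. For collinear points both contain a division by zero and equal 0. *)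
Lemma cot_angleE A B C : A != B -> C != B ->
  cos (angle A B C) / line_dist A B C =
  dot (A - B) (C - B) / (enorm (A - B) * `|cross (A - B) (C - B)|).
Proof.
move=> AB CB; rewrite cos_angle// line_distE//.
have [->|c0] := eqVneq (cross (A - B) (C - B)) 0.
  by rewrite normr0 mulr0 mul0r invr0 !mulr0.
by move: AB CB; rewrite -(subr_eq0 A) -(subr_eq0 C) -!enorm_gt0 => ? ?;
  field; rewrite !gt_eqF ?normr_gt0.
Qed.

(* With l = |AB|: (cot A + cot B) / l = 1 / (height on AB). *)
Lemma cot_angleD A B C : cross (A - C) (B - C) != 0 ->
  cos (angle A B C) / line_dist A B C + cos (angle B A C) / line_dist B A C
  = 1 / line_dist C A B.
Proof.
move=> c0; have e1 : cross (A - B) (C - B) = cross (A - C) (B - C) * -1.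
  by rewrite /cross !mxE; ring.
have e2 : cross (B - A) (C - A) = cross (A - C) (B - C).
  by rewrite /cross !mxE; ring.
have e3 : cross (C - A) (B - A) = cross (A - C) (B - C) * -1.
  by rewrite /cross !mxE; ring.
have c1 : cross (A - B) (C - B) != 0 by rewrite e1 mulrN1 oppr_eq0.
have /andP[AB CB] := cross_neq0 c1.
have c2 : cross (C - A) (B - A) != 0 by rewrite e3 mulrN1 oppr_eq0.
have /andP[CA BA] := cross_neq0 c2.
move: (AB) (CB) (CA) (BA); rewrite !subr_eq0 => *.
rewrite !cot_angleE// line_distE// e1 e2 e3 !normrM !normrN !normr1 !mulr1.
rewrite -(opprB B A) (enormN (B - A)).
(* The signed projections of the other two sides onto AB add up to AB, so the two numerators sum to
   the square of |AB|. *)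
have -> : dot (- (B - A)) (C - B) = enorm (B - A) ^+ 2 - dot (B - A) (C - A).
  by rewrite enorm_sq !dotE !mxE; ring.
by field; rewrite normr_eq0 c0 gt_eqF// enorm_gt0.
Qed.

Lemma cramer u w z : cross u w != 0 ->
  z = (cross z w / cross u w) *: u + (cross u z / cross u w) *: w.
Proof.
by move=> c0; apply: eq_plane; rewrite !mxE; move: c0; rewrite /cross => c0; field.
Qed.

(** * Polar angles and open cones *)

Lemma polar_angle_range u : u != 0 -> 0 <= polar_angle u < 2 * pi.
Proof.
move=> u0.
have n0 : 0 < enorm u by rewrite enorm_gt0.
have sq := enorm_sq u; rewrite dotE in sq.
have b : -1 <= u 0 0 / enorm u <= 1.
  by rewrite ler_pdivlMr// ler_pdivrMr//; apply/andP; split; nra.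
have p0 := pi_gt0 R.
have a0 := acos_ge0 b; have a1 := acos_lepi b.
rewrite /polar_angle; case: ifP => s; first by rewrite a0; lra.
(* Below the first axis the [acos] is positive, so the value 2 pi is never reached. *)
suff : 0 < acos (u 0 0 / enorm u) by lra.
rewrite acos_gt0//; case/andP: b => -> _ /=.
by rewrite ltr_pdivrMr// mul1r; nra.
Qed.

Lemma polar_angleE u : u != 0 ->
  (u 0 0 = enorm u * cos (polar_angle u)) * (u 0 1 = enorm u * sin (polar_angle u)).
Proof.
move=> u0; have n0 : 0 < enorm u by rewrite enorm_gt0.
have sq := enorm_sq u; rewrite dotE in sq.
have b : -1 <= u 0 0 / enorm u <= 1.
  by rewrite ler_pdivlMr// ler_pdivrMr//; apply/andP; split; nra.
have e : Num.sqrt (1 - (u 0 0 / enorm u) ^+ 2) = `|u 0 1| / enorm u.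
  apply/eqP; rewrite -(@eqrXn2 _ 2) ?sqrtr_ge0 ?divr_ge0 ?(ltW n0)//.
  rewrite sqr_sqrtr; last first.
    by rewrite subr_ge0 -real_normK ?num_real// expr_le1 // ler_norml.
  rewrite !exprMn !exprVn real_normK ?num_real// sq.
  by apply/eqP; have : enorm u ^+ 2 != 0 by [rewrite expf_eq0 /= gt_eqF]; rewrite sq => ?; field.
rewrite /polar_angle; case: ifP => s.
  rewrite acosK ?in_itv//= sin_acos// e ger0_norm//.
  by split; rewrite mulrC divfK// gt_eqF.
rewrite mulr_natl cosB sinB cos2pi sin2pi acosK ?in_itv//= sin_acos// e.
rewrite ltr0_norm; last by rewrite ltNge s.
by split; field; rewrite gt_eqF.
Qed.

Lemma cross_polar u v : u != 0 -> v != 0 ->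
  cross u v = enorm u * enorm v * sin (polar_angle v - polar_angle u).
Proof.
move=> u0 v0; rewrite /cross !(polar_angleE u0) !(polar_angleE v0) sinB; ring.
Qed.

Lemma sin_gt0_range (x : R) : - pi < x < 2 * pi -> (0 < sin x) = (0 < x < pi).
Proof.
have p0 := pi_gt0 R => /andP[xl xr].
have [xp|xp] := leP x 0.
  rewrite andFb; apply/negbTE; rewrite -leNgt -oppr_ge0 -sinN sin_ge0_pi//; lra.
have [xq|xq] := ltP x pi; first by rewrite sin_gt0_pi// xp.
apply/negbTE; rewrite -leNgt.
have -> : x = (x - pi) + pi by ring.
by rewrite sinDpi oppr_le0 sin_ge0_pi//; lra.
Qed.

(** The disjunction places [z] strictly inside the counterclockwise arc from [u] to [w]; its second
    alternative is an arc that passes the first axis. Since [cross u w] is positive, the arc is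
    shorter than pi, and [z] lies in the open cone. *)
Lemma polar_between u w z : u != 0 -> w != 0 -> z != 0 -> 0 < cross u w ->
  (polar_angle u < polar_angle z < polar_angle w \/
   polar_angle w < polar_angle u /\
     (polar_angle u < polar_angle z \/ polar_angle z < polar_angle w)) ->
  0 < cross u z /\ 0 < cross z w.
Proof.
move=> u0 w0 z0; rewrite !cross_polar//.
have [nu nw nz] : [/\ 0 < enorm u, 0 < enorm w & 0 < enorm z].
  by rewrite !enorm_gt0.
rewrite !pmulr_rgt0 ?mulr_gt0//.
have := polar_angle_range u0; have := polar_angle_range w0; have := polar_angle_range z0.
move: (polar_angle u) (polar_angle w) (polar_angle z) => a b c rc rb ra.
have p0 := pi_gt0 R.
have sin2 (x : R) : sin x = sin (x + 2 * pi) by rewrite mulr_natl sinD cos2pi sin2pi; ring.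
have [ab|ba|->] := ltgtP a b; last by rewrite subrr sin0 ltxx.
  rewrite sin_gt0_range; last lra.
  move=> ? [?|[? _]]; last by exfalso; lra.
  by rewrite !sin_gt0_range; lra.
(* The arc passes the first axis here; negative differences of angles are moved into (0, 2 pi) by
   adding 2 pi. *)
rewrite sin2 sin_gt0_range; last lra.
move=> ? [?|[_ ?]]; first by exfalso; lra.
have [ac|ca] := ltP a c.
  rewrite [in X in _ /\ X]sin2 !sin_gt0_range; lra.
rewrite [in X in X /\ _]sin2 !sin_gt0_range; lra.
Qed.

Lemma polar_angle_eq u v : u != 0 -> v != 0 -> polar_angle u = polar_angle v ->
  v = (enorm v / enorm u) *: u.
Proof.
move=> u0 v0 e; have n0 : enorm u != 0 by rewrite gt_eqF// enorm_gt0.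
by apply: eq_plane; rewrite mxE !(polar_angleE u0) !(polar_angleE v0) e; field.
Qed.

End Plane.

(** The excluded condition says that [f c] is strictly between [f a] and [f b] in cyclic order,
    phrased as in [polar_between]. A successor of [a] other than [b] would satisfy it. *)
Lemma next_sorted (R : realDomainType) (T : eqType) (f : T -> R) (s : seq T) (a b : T) :
  uniq s -> {in s &, injective f} -> sorted (fun x y => f x <= f y) s ->
  a \in s -> b \in s -> a != b ->
  (forall c, c \in s ->
     ~ (f a < f c < f b \/ f b < f a /\ (f a < f c \/ f c < f b))) ->
  next s a = b.
Proof.
move=> us fI ss sa sb ab nob.
have lt_nth i j : (i < j)%N -> (j < size s)%N -> f (nth a s i) < f (nth a s j).
  move=> ij js; have si := ltn_trans ij js; rewrite lt_neqAle; apply/andP; split.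
    apply/eqP => /fI; rewrite !mem_nth// => /(_ isT isT) /eqP.
    by rewrite nth_uniq// ltn_eqF.
  apply: (sorted_leq_nth _ _ _ ss) => //; first by move=> ? ? ?; apply: le_trans.
  exact: ltnW.
rewrite next_nth sa.
case: s => // y p in us fI ss sa sb nob lt_nth *.
set s := y :: p in us fI ss sa sb nob lt_nth *.
have ia : (index a s < size s)%N by rewrite index_mem.
have ib : (index b s < size s)%N by rewrite index_mem.
have fa : f a = f (nth a s (index a s)) by rewrite nth_index.
have fb : f b = f (nth a s (index b s)) by rewrite nth_index.
have iab : index a s != index b s.
  by apply: contra ab => /eqP e; rewrite -(nth_index a sa) e nth_index.
have [ab_lt|ba_lt|e] := ltngtP (index a s) (index b s); last by rewrite e eqxx in iab.
  have ips : ((index a s).+1 <= index b s)%N by [].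
  move: ips; rewrite leq_eqVlt => /orP[/eqP e|lt].
    have -> : nth y p (index a s) = nth y s (index a s).+1 by [].
    by rewrite e nth_index.
  exfalso; apply: (nob (nth a s (index a s).+1)).
    by rewrite mem_nth// (ltn_trans lt).
  by left; rewrite fa fb !lt_nth// (ltn_trans lt).
have fba : f b < f a by rewrite fa fb lt_nth.
(* As [b] precedes [a], it must be the head and [a] the last entry: an entry before [b] or after [a]
   would lie on the arc that wraps around. *)
have [b0|b0] := posnP (index b s); last first.
  exfalso; apply: (nob (nth a s 0)); first by rewrite mem_nth.
  by right; split=> //; right; rewrite fb lt_nth.
have yb : y = b by rewrite -[y]/(nth y s 0) -b0 nth_index.
have [lt|le] := ltnP (index a s).+1 (size s).
  exfalso; apply: (nob (nth a s (index a s).+1)); first by rewrite mem_nth.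
  by right; split=> //; left; rewrite {1}fa lt_nth.
(* With [a] last, [nth] runs past the tail and returns its default [y], the head, which is [b]. *)
by rewrite nth_default.
Qed.

(** The reciprocal of 1 plus the sum of all [(d t)^-1] lies below every [d t], and is positive even
    when [T] is empty. *)
Lemma finType_near0 (R : realFieldType) (T : finType) (P : T -> R -> Prop) :
  (forall t, exists2 d, 0 < d & forall x, 0 < x < d -> P t x) ->
  exists2 d, 0 < d & forall x, 0 < x < d -> forall t, P t x.
Proof.
move=> /fin_all_exists2 [d d0 dP].
have inv0 t : 0 < (d t)^-1 by rewrite invr_gt0.
have s0 : 0 <= \sum_t (d t)^-1 by apply: sumr_ge0 => t _; exact: ltW.
exists (1 + \sum_t (d t)^-1)^-1; first by rewrite invr_gt0; lra.
move=> x /andP[x0 xd] t; apply: dP; rewrite x0/= (lt_trans xd)//.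
rewrite -[ltRHS]invrK ltf_pV2 ?posrE//; last lra.
rewrite (bigD1 t)//=.
have : 0 <= \sum_(i | i != t) (d i)^-1 by apply: sumr_ge0 => i _; exact: ltW.
lra.
Qed.

(** * Triangles and cyclic order around a vertex *)

Section Trig.
Variable V : finType.
Implicit Types a b c : V.

Lemma trigA a b c : trig a b c = trig b c a.
Proof. by rewrite /trig -finset.setUA finset.setUC. Qed.

Lemma trigC a b c : trig a b c = trig b a c.
Proof. by rewrite /trig (finset.setUC [set a]%SET). Qed.

Lemma in_trig a b c x : (x \in trig a b c) = [|| x == a, x == b | x == c].
Proof. by rewrite !inE orbA. Qed.

Lemma card_trig a b c : (#|trig a b c| == 3) = uniq [:: a; b; c].
Proof.
rewrite /trig -finset.setUA cardsU1 cards2 /= !inE andbT.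
by case: (_ || _); case: (b == c).
Qed.

Lemma segmC a b : segm a b = segm b a.
Proof. exact: finset.setUC. Qed.

Lemma segm_eq a b c d : segm a b = segm c d -> a = c /\ b = d \/ a = d /\ b = c.
Proof.
move=> e.
have := set21 a b; rewrite -/(segm a b) e !inE => /orP[] /eqP ac.
  left; split=> //; subst c.
  have := set22 a b; rewrite -/(segm a b) e !inE => /orP[] /eqP // ba; subst b.
  by have := set22 a d; rewrite -/(segm a d) -e !inE orbb => /eqP.
right; split=> //; subst d.
have := set22 a b; rewrite -/(segm a b) e !inE => /orP[] /eqP // ba; subst b.
by have := set21 c a; rewrite -/(segm c a) -e !inE orbb => /eqP.
Qed.

Lemma sum_trig (M : nmodType) a b c (F : V -> M) : uniq [:: a; b; c] ->
  \sum_(x in trig a b c) F x = F a + F b + F c.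
Proof.
move=> u; transitivity (\sum_(x <- [:: a; b; c]) F x); last first.
  by rewrite !big_cons big_nil addr0 addrA.
rewrite big_uniq//=; apply: eq_bigl => x.
by rewrite in_trig !inE.
Qed.

End Trig.

Section Tri.
Variables (R : realType) (V : finType) (S : triangulated_structure R V).
Implicit Types (v a b c : V) (s t : {set V}).
Local Notation pos := (pos S).
Local Notation area v a b := (cross (pos a - pos v) (pos b - pos v)).

Lemma area_rot v a b : area a b v = area v a b.
Proof. by rewrite /cross !mxE; ring. Qed.

Lemma area_swap v a b : area a v b = - area v a b.
Proof. by rewrite /cross !mxE; ring. Qed.

Lemma area_uniq v a b : area v a b != 0 -> uniq [:: v; a; b].
Proof.
apply: contraR; rewrite /= !inE andbT -negb_or negbK /cross.
by move=> /orP[/orP[]|] /eqP ->; rewrite !mxE; apply/eqP; ring.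
Qed.

Lemma tri_uniq v a b : trig v a b \in tris S -> uniq [:: v; a; b].
Proof.
move=> tS; have [x [y [z [e /area_uniq u]]]] := tri_nondegenerate tS.
by rewrite -card_trig e card_trig.
Qed.

Lemma tri_area v a b : trig v a b \in tris S -> area v a b != 0.
Proof.
move=> tS; have u := tri_uniq tS.
have [x [y [z [e A]]]] := tri_nondegenerate tS.
have : v \in trig x y z by rewrite -e in_trig eqxx.
have : a \in trig x y z by rewrite -e in_trig eqxx orbT.
have : b \in trig x y z by rewrite -e in_trig eqxx !orbT.
have a1 := area_rot x y z; have a2 := area_rot y z x; have a3 := area_swap x y z.
have a4 := area_rot y x z; have a5 := area_rot x z y.
move: u; rewrite /= !in_trig !inE => u /or3P[] /eqP ? /or3P[] /eqP ? /or3P[] /eqP ?;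
  subst v a b; move: u; rewrite ?eqxx ?orbT ?andbF //= => _.
all: by rewrite ?(a5, a4, a3, a2, a1) ?oppr_eq0.
Qed.

Lemma tri_mem2 t v a : t \in tris S -> v \in t -> a \in t -> v != a ->
  exists b, t = trig v a b.
Proof.
move=> tS vt at_ va.
have t3 : #|t| = 3.
  have [x [y [z [-> A]]]] := tri_nondegenerate tS.
  by apply/eqP; rewrite card_trig; exact: area_uniq A.
have : #|(t :\ v :\ a)%SET| == 1.
  have := cardsD1 v t; rewrite t3 vt (cardsD1 a) !inE eq_sym va at_.
  by rewrite !add1n => -[<-].
move=> /cards1P[b e]; exists b; apply/setP => x; rewrite in_trig.
have <- : (x \in t :\ v :\ a)%SET = (x == b) by rewrite e inE.
rewrite !inE; case: eqVneq => [->//|_]; case: eqVneq => [->|//]; by rewrite at_.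
Qed.

(** These are barycentric coordinates with origin [v], whose own weight is 1 - m - n; membership in
    a triangle becomes linear inequalities. *)
Lemma hull_trigP v a b x : trig v a b \in tris S ->
  hull pos (trig v a b) x <->
  exists m n, [/\ 0 <= m, 0 <= n, m + n <= 1 &
    x = pos v + (m *: (pos a - pos v) + n *: (pos b - pos v))].
Proof.
move=> tS; have u := tri_uniq tS; split.
  move=> [w [w0]]; rewrite (sum_trig _ u) => w1 <-.
  exists (w a), (w b); rewrite !w0; split=> //; first by have := w0 v; lra.
  rewrite (sum_trig _ u); have -> : w v = 1 - w a - w b by lra.
  by apply: eq_plane; rewrite !mxE; ring.
move=> [m [n [m0 n0 mn ->]]].
exists (fun y => if y == v then 1 - m - n else if y == a then m else n).
  split=> [y|]; first by do 2?case: ifP => // _; lra.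
  move: (u) => /=; rewrite !inE negb_or andbT => /andP[/andP[va vb] ab].
  rewrite (sum_trig _ u) eqxx [a == v]eq_sym (negbTE va) eqxx [b == v]eq_sym.
  by rewrite (negbTE vb) [b == a]eq_sym (negbTE ab); ring.
move: (u) => /=; rewrite !inE negb_or andbT => /andP[/andP[va vb] ab].
rewrite (sum_trig _ u) eqxx [a == v]eq_sym (negbTE va) eqxx [b == v]eq_sym.
rewrite (negbTE vb) [b == a]eq_sym (negbTE ab).
by apply: eq_plane; rewrite !mxE; ring.
Qed.

Lemma bary_inj (p q : 'rV[R]_2) (m n m' n' : R) : cross p q != 0 ->
  m *: p + n *: q = m' *: p + n' *: q -> m = m' /\ n = n'.
Proof.
move=> c0 e.
have c1 : cross (m *: p + n *: q) q = m * cross p q.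
  by rewrite /cross !mxE; ring.
have c2 : cross p (m *: p + n *: q) = n * cross p q.
  by rewrite /cross !mxE; ring.
split; apply: (mulIf c0).
  by rewrite -c1 e /cross !mxE; ring.
by rewrite -c2 e /cross !mxE; ring.
Qed.

(** By [tri_meet] the point is a convex combination of the common vertices of the two triangles.
    Barycentric coordinates being unique, each vertex of positive weight is common. This is how
    geometric overlap yields shared vertices below. *)
Lemma tri_support v a b s (m n : R) :
  trig v a b \in tris S -> s \in tris S ->
  0 <= m -> 0 <= n -> m + n <= 1 ->
  hull pos s (pos v + (m *: (pos a - pos v) + n *: (pos b - pos v))) ->
  [/\ m + n < 1 -> v \in s, 0 < m -> a \in s & 0 < n -> b \in s].
Proof.
move=> tS sS m0 n0 mn hs.
have [->|st] := eqVneq s (trig v a b).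
  by rewrite !in_trig !eqxx !orbT.
set x := (X in hull _ _ X) in hs.
have ht : hull pos (trig v a b) x by apply/hull_trigP => //; exists m, n.
have : (hull pos s `&` hull pos (trig v a b))%classic x by [].
rewrite tri_meet// => -[w [w0 w1] xE].
have u := tri_uniq tS.
(* Extending the weights by zero turns sums over the intersection into sums over all three
   vertices. *)
pose w' y := if y \in s then w y else 0.
have sumE (M : nmodType) (F : V -> M) :
    \sum_(y in (s :&: trig v a b)%SET) F y =
    \sum_(y in trig v a b) if y \in s then F y else 0.
  rewrite -big_mkcondr/=; apply: eq_bigl => y; by rewrite inE andbC.
have w1' : w' v + w' a + w' b = 1 by rewrite -w1 sumE (sum_trig _ u).
have xE' : x = w' v *: pos v + w' a *: pos a + w' b *: pos b.
  rewrite -xE sumE (sum_trig _ u) /w'.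
  by congr (_ + _ + _); case: ifP => // _; rewrite scale0r.
have [] : m = w' a /\ n = w' b.
  apply: (bary_inj (tri_area tS)).
  apply: (addrI (pos v)); rewrite -/x xE'.
  have -> : w' v = 1 - w' a - w' b by lra.
  by apply: eq_plane; rewrite !mxE; ring.
move=> ma nb; split.
- have : w' v = 1 - m - n by lra.
  by rewrite /w'; case: ifP => // _; lra.
- by rewrite ma /w'; case: ifP; rewrite ?ltxx.
- by rewrite nb /w'; case: ifP; rewrite ?ltxx.
Qed.

Lemma adjacentP v a :
  reflect (v != a /\ exists b, trig v a b \in tris S) (Defs.adjacent S v a).
Proof.
rewrite /Defs.adjacent /edges inE cards2; apply: (iffP andP).
  move=> [va /exists_inP[t tS /fintype.subsetP sub]].
  have {}va : v != a by move: va; case: (v != a).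
  split=> //.
  have [b e] := tri_mem2 tS (sub v (set21 _ _)) (sub a (set22 _ _)) va.
  by exists b; rewrite -e.
move=> [va [b tS]]; rewrite va; split=> //; apply/exists_inP; exists (trig v a b) => //.
by apply/fintype.subsetP => x; rewrite in_trig !inE => /orP[] ->; rewrite ?orbT.
Qed.

Lemma tri_adjacent v a b : trig v a b \in tris S -> Defs.adjacent S v a.
Proof.
move=> tS; apply/adjacentP; split; last by exists b.
by have /= := tri_uniq tS; rewrite !inE negb_or => /andP[/andP[]].
Qed.

Lemma adjacentC v a : Defs.adjacent S v a = Defs.adjacent S a v.
Proof. by rewrite /Defs.adjacent segmC. Qed.

Lemma pos_sub_neq0 v a : v != a -> pos a - pos v != 0.
Proof. by rewrite subr_eq0 => va; apply: contra va => /eqP /pos_inj ->. Qed.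

(** Distinct spokes in one direction would share the point at parameter k / (1 + k) on [va] and 1 /
    (1 + k) on [vc]. By [tri_support] a triangle [v c d] then contains [a], so [d] is [a] and the
    triangle is degenerate. *)
Lemma spokes_dir_inj v a c (k : R) : Defs.adjacent S v a -> Defs.adjacent S v c ->
  0 < k -> pos c - pos v = k *: (pos a - pos v) -> a = c.
Proof.
move=> /adjacentP[va [b tS]] /adjacentP[vc [d sS]] k0 e.
apply/eqP/negPn/negP => ac.
have k1 : 0 < 1 + k by lra.
have ik : 0 < (1 + k)^-1 by rewrite invr_gt0.
have ik1 : (1 + k)^-1 < 1 by rewrite invf_lt1//; lra.
have kk : k / (1 + k) = 1 - (1 + k)^-1 by field; rewrite gt_eqF.
have h : hull pos (trig v c d) (pos v + ((k / (1 + k)) *: (pos a - pos v) + 0 *: (pos b - pos v))).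
  apply/hull_trigP => //; exists (1 + k)^-1, 0; split=> //; rewrite ?(ltW ik)//; first lra.
  rewrite !scale0r !addr0 e scalerA; congr (_ + _ *: _).
  by rewrite mulrC.
have [|||_ as_ _] := tri_support tS sS _ _ _ h; try lra.
have {}as_ : a \in trig v c d by apply: as_; lra.
move: as_; rewrite in_trig [a == v]eq_sym (negbTE va) (negbTE ac) /= => /eqP ad.
have := tri_area sS; rewrite -ad e /cross !mxE => /eqP; apply; ring.
Qed.

(** A spoke [vc] inside the cone contains a point whose three weights in [v a b] are all positive,
    so a triangle [v c d] contains both [a] and [b]. Neither can be [c], which is strictly inside
    the cone, and they cannot both be [d]. *)
Lemma no_spoke_in_tri v a b c : trig v a b \in tris S -> Defs.adjacent S v c ->
  0 < area v a b -> ~ (0 < area v a c /\ 0 < area v c b).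
Proof.
move=> tS /adjacentP[vc [d sS]] D [ac cb].
set m := area v c b / area v a b; set n := area v a c / area v a b.
have m0 : 0 < m by rewrite divr_gt0.
have n0 : 0 < n by rewrite divr_gt0.
have e : pos c - pos v = m *: (pos a - pos v) + n *: (pos b - pos v).
  by apply: cramer; rewrite gt_eqF.
set k := (1 + m + n)^-1.
have k0 : 0 < k by rewrite invr_gt0; lra.
have kE : k + k * m + k * n = 1 by rewrite /k; field; rewrite gt_eqF//; lra.
have km : 0 < k * m by rewrite mulr_gt0.
have kn : 0 < k * n by rewrite mulr_gt0.
have h : hull pos (trig v c d)
    (pos v + ((k * m) *: (pos a - pos v) + (k * n) *: (pos b - pos v))).
  apply/hull_trigP => //; exists k, 0; split=> //; rewrite ?(ltW k0)//; first lra.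
  by rewrite -(scalerA k m) -(scalerA k n) -scalerDr -e scale0r addr0.
have [|||_ as_ bs] := tri_support tS sS _ _ _ h; try lra.
have /= := tri_uniq tS; rewrite !inE negb_or andbT => /andP[/andP[va vb] ab].
have := as_ km; rewrite in_trig [a == v]eq_sym (negbTE va) /= => /orP[] /eqP ad.
  by move: ac; rewrite ad /cross mulrC subrr ltxx.
have := bs kn; rewrite in_trig [b == v]eq_sym (negbTE vb) /= => /orP[] /eqP bd.
  by move: cb; rewrite bd /cross mulrC subrr ltxx.
by rewrite ad bd eqxx in ab.
Qed.

Lemma mem_spokes v a : (a \in spokes S v) = Defs.adjacent S v a.
Proof. by rewrite mem_sort mem_enum. Qed.

Lemma spokes_uniq v : uniq (spokes S v).
Proof. by rewrite sort_uniq enum_uniq. Qed.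

Lemma spoke_dir_neq0 v a : Defs.adjacent S v a -> pos a - pos v != 0.
Proof. by case/adjacentP => va _; exact: pos_sub_neq0. Qed.

(** A spoke cyclically between [a] and [b] would lie in the open cone by [polar_between], against
    [no_spoke_in_tri]. *)
Lemma next_spokes v a b : trig v a b \in tris S -> 0 < area v a b ->
  next (spokes S v) a = b.
Proof.
move=> tS D; have va := tri_adjacent tS.
have vb : Defs.adjacent S v b by apply: (@tri_adjacent v b a); rewrite trigA trigC trigA trigA.
apply: (next_sorted (f := fun x => polar_angle (pos x - pos v))) => //.
- exact: spokes_uniq.
- move=> x y; rewrite !mem_spokes => vx vy e.
  have x0 := spoke_dir_neq0 vx; have y0 := spoke_dir_neq0 vy.
  apply: (spokes_dir_inj vx vy _ (polar_angle_eq x0 y0 e)).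
  by rewrite divr_gt0 ?enorm_gt0.
- by apply: sort_sorted => x y; exact: le_total.
- by rewrite mem_spokes.
- by rewrite mem_spokes.
- by have /= := tri_uniq tS; rewrite !inE andbT => /andP[].
move=> c; rewrite mem_spokes => vc.
move/(polar_between (spoke_dir_neq0 va) (spoke_dir_neq0 vb) (spoke_dir_neq0 vc) D).
exact: no_spoke_in_tri.
Qed.

Lemma prev_spokes v a b : trig v a b \in tris S -> area v a b < 0 ->
  prev (spokes S v) a = b.
Proof.
move=> tS D; have tS' : trig v b a \in tris S by rewrite trigA trigC trigA trigA.
rewrite -(@next_spokes v b a) //; first by rewrite prev_next ?spokes_uniq.
by rewrite crossC oppr_gt0.
Qed.

(** Third vertices on the same side of [va] would both be the successor, or both the predecessor, of
    [a] around [v]. *)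
Lemma tri_opposite v a b c : trig v a b \in tris S -> trig v a c \in tris S ->
  b != c -> area v a b * area v a c < 0.
Proof.
move=> tb tc; apply: contraNT; rewrite -leNgt => D.
have nb := tri_area tb; have nc := tri_area tc.
have [b0|b0] := ltP (area v a b) 0.
  by rewrite -(prev_spokes tb b0) (prev_spokes tc)//; nra.
rewrite -(next_spokes tb) ?(next_spokes tc)//; first by nra.
by rewrite lt_neqAle eq_sym nb.
Qed.

End Tri.

(** A negative [m] keeps [m + x * k] negative for small [x]. This supplies the closedness of
    triangles along a ray. *)
Lemma affine_ge0_near0 (R : realFieldType) (m k : R) :
  exists2 d, 0 < d & forall x, 0 < x < d -> 0 <= m + x * k -> 0 <= m.
Proof.
have [m0|m0] := leP 0 m; first by exists 1.
have k0 : 0 < 1 + `|k| by rewrite ltr_pwDl.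
exists (- m / (1 + `|k|)); first by rewrite divr_gt0// oppr_gt0.
move=> x /andP[x0]; rewrite ltr_pdivlMr// => xk.
have : x * k <= x * `|k| by rewrite ler_pM2l// ler_norm.
lra.
Qed.

Section SumDelta.
Variables (R : realType) (V : finType) (I : eqType) (s : seq I).
Implicit Types (g : I -> {set V}) (c : I -> R) (e : {set V}).

(** Collects a sum over spokes edge by edge, for use in [sigma_linear]. *)
Lemma sum_delta g c (E : {set {set V}}) (L : {set V} -> R) :
  {in s, forall x, g x \in E} ->
  \sum_(x <- s) c x * L (g x) =
  \sum_(e in E) (\sum_(x <- s) c x * (g x == e)%:R) * L e.
Proof.
move=> gE; under [RHS]eq_bigr do rewrite mulr_suml.
rewrite exchange_big/= big_seq [RHS]big_seq; apply: eq_bigr => x xs.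
rewrite (bigD1 (g x)) ?gE//= eqxx mulr1 big1 ?addr0// => e /andP[_ eg].
by rewrite eq_sym (negbTE eg) mulr0 mul0r.
Qed.

Lemma sum_delta0 g c e : {in s, forall x, g x != e} ->
  \sum_(x <- s) c x * (g x == e)%:R = 0.
Proof.
by move=> ge; rewrite big_seq big1// => x /ge /negbTE ->; rewrite mulr0.
Qed.

Lemma sum_delta1 g c e a : uniq s -> a \in s -> g a = e ->
  {in s, forall x, g x = e -> x = a} ->
  \sum_(x <- s) c x * (g x == e)%:R = c a.
Proof.
move=> us as_ ga gI; rewrite (bigD1_seq a)//= ga eqxx mulr1 big_seq_cond.
rewrite big1 ?addr0// => x /andP[xs xa]; case: eqP => [/(gI _ xs) xE|_].
  by rewrite xE eqxx in xa.
by rewrite mulr0.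
Qed.

End SumDelta.

(** * Interior vertices and coefficients *)

Section Interior.
Variables (R : realType) (V : finType) (S : triangulated_structure R V).
Implicit Types (v a b c : V) (s t e : {set V}).
Local Notation pos := (pos S).
Local Notation area v a b := (cross (pos a - pos v) (pos b - pos v)).

Lemma tri_closed_along t (x y : 'rV[R]_2) : t \in tris S ->
  exists2 d, 0 < d & forall k, 0 < k < d -> hull pos t (x + k *: y) -> hull pos t x.
Proof.
move=> tS; have [a [b [c [e A]]]] := tri_nondegenerate tS; rewrite e in tS *.
(* [m] and [n] are the barycentric coordinates by Cramer's rule. All three weights are affine along
   the ray, so each one has its own threshold. *)
pose m z := cross z (pos c - pos a) / area a b c.
pose n z := cross (pos b - pos a) z / area a b c.
have [d1 d10 h1] := affine_ge0_near0 (m (x - pos a)) (m y).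
have [d2 d20 h2] := affine_ge0_near0 (n (x - pos a)) (n y).
have [d3 d30 h3] := affine_ge0_near0
  (1 - m (x - pos a) - n (x - pos a)) (- m y - n y).
exists (Num.min d1 (Num.min d2 d3)); first by rewrite !lt_min d10 d20 d30.
move=> k; rewrite !lt_min => /andP[k0 /and3P[k1 k2 k3]] /(hull_trigP _ tS).
move=> [m' [n' [m0 n0 mn xE]]].
have {}xE : (x - pos a) + k *: y =
    m' *: (pos b - pos a) + n' *: (pos c - pos a).
  by apply: (addrI (pos a)); rewrite -xE addrA addrCA subrr addr0.
have mE : m' = m (x - pos a) + k * m y.
  transitivity (m (x - pos a + k *: y)).
    by rewrite xE /m; move: A; rewrite /cross !mxE => A; field.
  by rewrite /m; move: A; rewrite /cross !mxE => A; field.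
have nE : n' = n (x - pos a) + k * n y.
  transitivity (n (x - pos a + k *: y)).
    by rewrite xE /n; move: A; rewrite /cross !mxE => A; field.
  by rewrite /n; move: A; rewrite /cross !mxE => A; field.
apply/(hull_trigP _ tS); exists (m (x - pos a)), (n (x - pos a)); split.
- by apply: (h1 k); rewrite ?k0 ?k1// -mE.
- by apply: (h2 k); rewrite ?k0 ?k2// -nE.
- suff : 0 <= 1 - m (x - pos a) - n (x - pos a) by lra.
  apply: (h3 k); rewrite ?k0 ?k3//.
  by rewrite mulrBr mulrN; lra.
- by rewrite -cramer// addrC subrK.
Qed.

(* For a small fixed q, the points v + q u + k (q n) lie in the carrier; as k
   tends to 0 some triangle catches them, hence by closedness also v + q u,
   which is interior to the edge va, so that this triangle has va as an edge. *)
Lemma interior_tri_side v a (n : 'rV[R]_2) :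
  is_interior S v -> Defs.adjacent S v a -> cross (pos a - pos v) n != 0 ->
  exists2 b, trig v a b \in tris S & 0 < area v a b * cross (pos a - pos v) n.
Proof.
move=> /asboolP vint /[dup] va /adjacentP[v_a [b0 t0S]] un.
have /nbhs_ballP[r /= r0 rsub] : nbhs (pos v) (carrier S) by exact: vint.
set u := pos a - pos v in un *.
have M0 : 0 <= `|u| + `|n| by rewrite addr_ge0.
(* [q < 1] keeps [v + q u] strictly before [a]; the bound [qr] keeps all points [v + q (u + k n)]
   with 0 < k < 1 in the ball of radius [r] about [v]. *)
set q := r / (r + (`|u| + `|n|) + 1).
have q0 : 0 < q by rewrite divr_gt0//; lra.
have q1 : q < 1 by rewrite ltr_pdivrMr; lra.
have qr : q * (`|u| + `|n|) < r.
  by rewrite /q mulrAC ltr_pdivrMr ?ltr_pM2l//; lra.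
have near_t t : exists2 d, 0 < d & forall k, 0 < k < d ->
    t \in tris S -> hull pos t (pos v + q *: u + k *: (q *: n)) ->
    hull pos t (pos v + q *: u).
  have [tS|] := boolP (t \in tris S); last by exists 1.
  have [d d0 dP] := tri_closed_along (pos v + q *: u) (q *: n) tS.
  by exists d => // k kd _; exact: dP.
have [d d0 dP] := finType_near0 near_t.
set k := Num.min d 1 / 2.
have mn : 0 < Num.min d 1 by rewrite lt_min d0 ltr01.
have m1 : Num.min d 1 <= 1 by rewrite ge_min lexx orbT.
have md : Num.min d 1 <= d by rewrite ge_min lexx.
have k0 : 0 < k by rewrite divr_gt0.
have kd : k < d by rewrite /k; lra.
have k1 : k < 1 by rewrite /k; lra.
have : carrier S (pos v + q *: u + k *: (q *: n)).
  apply: rsub; rewrite -ball_normE /ball_/=.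
  have -> : pos v - (pos v + q *: u + k *: (q *: n)) = - (q *: (u + k *: n)).
    by apply: eq_plane; rewrite !mxE; ring.
  rewrite normrN normrZ gtr0_norm//.
  apply: le_lt_trans qr; rewrite ler_pM2l// (le_trans (ler_normD _ _))// lerD2l.
  by rewrite normrZ gtr0_norm// ler_piMl// ltW.
move=> [t /= tS ht].
have hx : hull pos t (pos v + q *: u) by apply: (dP k) => //; rewrite k0.
have hx' : hull pos t (pos v + (q *: (pos a - pos v) + 0 *: (pos b0 - pos v))).
  by rewrite scale0r addr0.
have [|||vt at_ _] := tri_support t0S tS _ _ _ hx'; rewrite ?(ltW q0)//; first lra.
have [|b tE] := tri_mem2 tS (vt _) (at_ q0) v_a; first lra.
rewrite tE in tS ht; exists b => //.
move/(hull_trigP _ tS): ht => [m' [n' [m0 n0 _ xE]]].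
have {}xE : q *: u + k *: (q *: n) = m' *: u + n' *: (pos b - pos v).
  by apply: (addrI (pos v)); rewrite -xE addrA.
(* The cross product with [u] removes the components along the edge and compares the sides of [b]
   and [n]. *)
have cE : n' * area v a b = q * k * cross u n.
  transitivity (cross u (m' *: u + n' *: (pos b - pos v))).
    by rewrite /cross !mxE; ring.
  by rewrite -xE /cross !mxE; ring.
have qk : 0 < q * k by rewrite mulr_gt0.
have n'0 : 0 < n'.
  rewrite lt_neqAle n0 andbT eq_sym; apply: contraNneq un => n'0.
  by move/eqP: cE; rewrite n'0 mul0r eq_sym mulf_eq0 gt_eqF.
rewrite -(pmulr_rgt0 _ qk) [_ * cross u n]mulrC mulrA -cE.
have A0 := tri_area tS.
by rewrite -mulrA pmulr_rgt0// -expr2 exprn_even_gt0.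
Qed.


Lemma interior_tri v a : is_interior S v -> Defs.adjacent S v a ->
  exists b c, [/\ trig v a b \in tris S, 0 < area v a b,
                  trig v a c \in tris S & area v a c < 0].
Proof.
move=> vint va; set u := pos a - pos v.
have u0 : u != 0 by exact: spoke_dir_neq0 va.
(* [n] is [u] turned counterclockwise by a right angle; [n] and [- n] probe the two sides of the
   edge. *)
pose n : 'rV[R]_2 := \row_i (if i == 0 then - u 0 1 else u 0 0).
have un : 0 < cross u n.
  have -> : cross u n = enorm u ^+ 2.
    by rewrite enorm_sq dotE /cross !mxE /=; ring.
  by rewrite exprn_gt0// enorm_gt0.
have uNn : cross u (- n) = - cross u n by rewrite /cross !mxE /=; ring.
have [b bS b0] := interior_tri_side vint va (lt0r_neq0 un).
have [|c cS c0] := interior_tri_side (n := - n) vint va.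
  by rewrite -/u uNn oppr_eq0 gt_eqF.
exists b, c; split=> //; first by rewrite -(pmulr_lgt0 _ un).
by rewrite -oppr_gt0 -(pmulr_lgt0 _ un) mulNr -mulrN -uNn.
Qed.

Lemma next_tri v a : is_interior S v -> Defs.adjacent S v a ->
  trig v a (next (spokes S v) a) \in tris S.
Proof.
by move=> vint /(interior_tri vint)[b [_ [bS b0 _ _]]]; rewrite (next_spokes bS).
Qed.

Lemma adjacent_neq v a : Defs.adjacent S v a -> v != a.
Proof. by case/adjacentP. Qed.

Lemma tri_swap v a b : (trig v b a \in tris S) = (trig v a b \in tris S).
Proof. by rewrite (trigA v b a) (trigC b a v) (trigA v a b) -trigA trigC. Qed.

Lemma tri_pos_neq v a b : trig v a b \in tris S ->
  [/\ pos v != pos a, pos v != pos b & pos a != pos b].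
Proof.
move=> /tri_uniq /=; rewrite !inE negb_or andbT => /andP[/andP[va vb] ab].
by split; rewrite (inj_eq (@pos_inj _ _ S)).
Qed.

(** * Coefficients of the wagon wheels and of their sum *)

Local Notation spoke_weight v a b :=
  (cos (angle (pos v) (pos a) (pos b)) / line_dist (pos v) (pos a) (pos b)).

Lemma coeff_wagon_wheelE v e (s := spokes S v) :
  coeff (wagon_wheel S v) e =
    \sum_(a <- s) (line_dist (pos v) (pos a) (pos (next s a)))^-1
                   * (segm a (next s a) == e)%:R
  - \sum_(a <- s) (spoke_weight v a (next s a)
      + cos (angle (pos v) (pos a) (pos (prev s a)))
        / line_dist (pos v) (pos (prev s a)) (pos (next s (prev s a))))
                   * (segm v a == e)%:R.
Proof.
rewrite /coeff /wagon_wheel; congr (_ - _).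
by apply: eq_bigr => x _; exact: mulrC.
Qed.

Lemma coeff_wagon_wheel0 v e : ~~ radial S v e -> ~~ circumferential S v e ->
  coeff (wagon_wheel S v) e = 0.
Proof.
move=> /hasPn nr /hasPn nc; rewrite coeff_wagon_wheelE.
by rewrite !sum_delta0 ?subrr// => a /[dup] aS; [move/nr|move/nc]; rewrite eq_sym.
Qed.

(** The gamma term divides by the distance to the line through [prev s a] and [a], so both terms are
    spoke weights, one per adjacent triangle. The result is symmetric in [b] and [c], so [b] may be
    taken as the successor. *)
Lemma coeff_radial v a b c : trig v a b \in tris S -> trig v a c \in tris S ->
  b != c ->
  coeff (wagon_wheel S v) (segm v a) = - (spoke_weight v a b + spoke_weight v a c).
Proof.
move=> bS cS bc; have va := tri_adjacent bS.
wlog b0 : b c bS cS bc / 0 < area v a b => [hw|].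
  have [b0|b0] := ltP 0 (area v a b); first exact: hw.
  rewrite addrC; apply: hw; rewrite 1?eq_sym//.
  by have := tri_opposite bS cS bc; have := tri_area bS; nra.
have c0 : area v a c < 0 by have := tri_opposite bS cS bc; nra.
(* Circumferential pairs consist of neighbors of [v] and never contain [v]. *)
rewrite coeff_wagon_wheelE sum_delta0 => [|x xs]; last first.
  apply/negP => /eqP e; have := set21 v a; rewrite -/(segm v a) -e !inE.
  have := xs; rewrite -mem_next; move: (next _ x) xs => y.
  rewrite !mem_spokes => /adjacent_neq vx /adjacent_neq vy.
  by rewrite (negbTE vx) (negbTE vy).
rewrite sub0r; congr (- _).
have nb := next_spokes bS b0; have pc := prev_spokes cS c0.
have na : next (spokes S v) c = a.
  by apply: next_spokes; rewrite 1?tri_swap// crossC oppr_gt0.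
have [_ _ ac] := tri_pos_neq cS.
rewrite (@sum_delta1 _ _ _ _ _ _ _ a); first by rewrite nb pc na (line_distC _ ac).
- exact: spokes_uniq.
- by rewrite mem_spokes.
- by [].
- by move=> x _ /segm_eq[[_ ->//]|[<- <-]].
Qed.

Lemma coeff_circumferential v a b : is_interior S v -> trig v a b \in tris S ->
  coeff (wagon_wheel S v) (segm a b) = 1 / line_dist (pos v) (pos a) (pos b).
Proof.
move=> vint; wlog b0 : a b / 0 < area v a b => [hw bS|bS].
  have [b0|b0] := ltP 0 (area v a b); first exact: hw.
  have [_ _ ab] := tri_pos_neq bS.
  rewrite segmC (line_distC _ ab); apply: hw; last by rewrite tri_swap.
  by rewrite crossC oppr_gt0 lt_neqAle b0 tri_area.
have va := tri_adjacent bS.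
have vb : Defs.adjacent S v b by apply: (@tri_adjacent _ _ S v b a); rewrite tri_swap.
rewrite coeff_wagon_wheelE [X in _ - X]sum_delta0 => [|x _]; last first.
  apply/negP => /eqP e; have := set21 v x; rewrite -/(segm v x) e !inE.
  by rewrite (negbTE (adjacent_neq va)) (negbTE (adjacent_neq vb)).
rewrite subr0 div1r (@sum_delta1 _ _ _ _ _ _ _ a) ?mem_spokes ?spokes_uniq ?(next_spokes bS)//.
move=> x _ /segm_eq[[-> //]|[xb nb]].
(* The pair could occur a second time only if [a] also followed [b]; interiority would then make
   [v b a] positively oriented, like [v a b]. *)
have [c [_ [cS c0 _ _]]] := interior_tri vint vb.
move: nb; rewrite xb (next_spokes cS)// => ca.
by move: c0; rewrite ca crossC oppr_gt0 => /(lt_trans b0); rewrite ltxx.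
Qed.

Lemma coeff_no_tri v a b : is_interior S v -> v != a -> v != b ->
  trig v a b \notin tris S -> coeff (wagon_wheel S v) (segm a b) = 0.
Proof.
move=> vint va vb nS; apply: coeff_wagon_wheel0; apply/hasPn => x xs.
  apply/negP => /eqP e; have := set21 v x; rewrite -/(segm v x) -e !inE.
  by rewrite (negbTE va) (negbTE vb).
apply: contra nS => /eqP e.
rewrite /trig -finset.setUA -/(segm a b) e finset.setUA.
by apply: next_tri; rewrite -?mem_spokes.
Qed.

Lemma sigma_coeffE e :
  coeff (sigma S) e = \sum_(v | is_interior S v) coeff (wagon_wheel S v) e.
Proof. by []. Qed.

Lemma sigma_coeff_near e : coeff (sigma S) e =
  \sum_(v | is_interior S v && (radial S v e || circumferential S v e))
     coeff (wagon_wheel S v) e.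
Proof.
rewrite sigma_coeffE [RHS]big_mkcondr; apply: eq_bigr => v _.
by case: ifPn => //; rewrite negb_or => /andP[]; exact: coeff_wagon_wheel0.
Qed.

(** By [next_tri] each circumferential pair at an interior vertex is a side of a triangle, so [L] is
    evaluated on genuine edges only. *)
Lemma sigma_linear (L : {set V} -> R) :
  sigma S L = \sum_(e in edges S) coeff (sigma S) e * L e.
Proof.
under [RHS]eq_bigr do rewrite sigma_coeffE mulr_suml.
rewrite exchange_big /=; apply: eq_bigr => v vint.
under [RHS]eq_bigr do rewrite coeff_wagon_wheelE mulrBl.
rewrite big_split /= sumrN -!sum_delta => [|x|x]; last 2 first.
- by rewrite mem_spokes.
- rewrite mem_spokes => /(next_tri vint); rewrite trigA.
  exact: tri_adjacent.
rewrite /wagon_wheel; congr (_ - _).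
by apply: eq_bigr => x _; exact: mulrC.
Qed.

(** Three distinct third vertices would have areas of pairwise opposite signs. *)
Lemma tri_third a b c d x : trig a b c \in tris S -> trig a b d \in tris S ->
  c != d -> trig a b x \in tris S -> x = c \/ x = d.
Proof.
move=> cS dS cd xS.
have [->|xc] := eqVneq x c; first by left.
have [->|xd] := eqVneq x d; first by right.
have h1 := tri_opposite cS dS cd; have h2 := tri_opposite xS cS xc.
have h3 := tri_opposite xS dS xd; exfalso.
have : 0 < (area a b c * area a b d) * (area a b x * area a b c)
  by rewrite nmulr_rgt0.
nra.
Qed.

(** By [tri_third] only these four vertices can contribute. The cancellation in [sigma_coeff_deep]
    and every case with two adjacent triangles are read off from this formula. *)
Lemma sigma_coeff_interior_edge a b c d :
  trig a b c \in tris S -> trig a b d \in tris S -> c != d ->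
  coeff (sigma S) (segm a b) =
    (if is_interior S a then - (spoke_weight a b c + spoke_weight a b d) else 0)
  + (if is_interior S b then - (spoke_weight b a c + spoke_weight b a d) else 0)
  + (if is_interior S c then 1 / line_dist (pos c) (pos a) (pos b) else 0)
  + (if is_interior S d then 1 / line_dist (pos d) (pos a) (pos b) else 0).
Proof.
move=> cS dS cd; rewrite sigma_coeffE big_mkcond/=.
have /= := tri_uniq cS; rewrite !inE negb_or andbT => /andP[/andP[ab ac] bc].
have /= := tri_uniq dS; rewrite !inE negb_or andbT => /andP[/andP[_ ad] bd].
rewrite (bigD1 a)//= (bigD1 b) 1?eq_sym//= (bigD1 c) /=; last first.
  by rewrite eq_sym ac eq_sym.
rewrite (bigD1 d) /=; last by rewrite eq_sym ad eq_sym bd eq_sym.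
rewrite big1 ?addr0 => [|x /andP[/andP[/andP[xa xb] xc] xd]]; last first.
  case: ifP => // xint; apply: coeff_no_tri => //; apply/negP; rewrite trigA => xS.
  by case: (tri_third cS dS cd xS) => xE; rewrite xE eqxx in xc xd.
rewrite !addrA; congr (_ + _ + _ + _); case: ifP => // vint.
- exact: coeff_radial.
- by rewrite segmC (coeff_radial (b := c) (c := d)) // trigC.
- by apply: coeff_circumferential => //; rewrite trigA.
- by apply: coeff_circumferential => //; rewrite trigA.
Qed.

(** * Vanishing away from the boundary of the region *)

Lemma vertex_hull t v : v \in t -> hull pos t (pos v).
Proof.
move=> vt; exists (fun y => (y == v)%:R); first split=> [y|].
- exact: ler0n.
- by rewrite (bigD1 v)//= eqxx big1 ?addr0// => y /andP[_ /negbTE ->].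
rewrite (bigD1 v)//= eqxx scale1r big1 ?addr0// => y /andP[_ /negbTE ->].
by rewrite scale0r.
Qed.

Lemma region_vertex v w t : is_interior S v -> t \in tris S -> v \in t ->
  w \in t -> region S (pos w).
Proof.
move=> vint tS vt wt; exists v => //; exists t; last exact: vertex_hull.
by split=> //; exact: vertex_hull.
Qed.

Lemma region_sub_carrier : (region S `<=` carrier S)%classic.
Proof. by move=> x [v _ [t [tS _] xt]]; exists t. Qed.

(** The boundary is that of the region but interiority refers to the carrier; the inclusion of the
    former in the latter links them. *)
Lemma region_interior v : region S (pos v) -> ~ on_boundary S v -> is_interior S v.
Proof.
move=> vr nb; apply/asboolP; apply: (interiorS region_sub_carrier).
apply: contrapT => vi; apply: nb; split=> //; exact: subset_closure.
Qed.

Lemma region_star_interior v w t : is_interior S v -> t \in tris S ->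
  v \in t -> w \in t -> ~ on_boundary S w -> is_interior S w.
Proof. by move=> vint tS vt wt; apply/region_interior/(region_vertex vint tS). Qed.

(** An interior vertex in a triangle with [a] would put [a] in the region, and off its boundary [a]
    would be interior. Hence no wagon wheel of an interior vertex sees the edge. *)
Lemma sigma_coeff_out a b : Defs.adjacent S a b -> ~~ is_interior S a ->
  ~ on_boundary S a -> coeff (sigma S) (segm a b) = 0.
Proof.
move=> /[dup] ab /adjacentP[a_b [c cS]] na nba.
have nint v t : t \in tris S -> v \in t -> a \in t -> ~~ is_interior S v.
  move=> tS vt at_; apply: contraNN na => vint.
  exact: (region_star_interior vint tS vt at_ nba).
clear nba; rewrite sigma_coeffE; apply: big1 => v vint; apply: coeff_no_tri => //.
- by apply: contraTneq vint => ->.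
- apply: contraTneq vint => ->; apply: (nint _ _ cS).
    by rewrite in_trig eqxx orbT.
  by rewrite in_trig eqxx.
- by apply: contraTN vint => vS; apply: (nint _ _ vS); rewrite in_trig eqxx ?orbT.
Qed.

(** If both endpoints are interior, the third vertices of the two triangles are neighbors of [a],
    hence off the boundary and interior too. The four contributions then cancel by [cot_angleD],
    once in each triangle. *)
Lemma sigma_coeff_deep a b : Defs.adjacent S a b ->
  ~ on_boundary S a -> ~ on_boundary S b -> ~ one_link_away S a ->
  coeff (sigma S) (segm a b) = 0.
Proof.
move=> ab nba nbb nl.
have [aint|aint] := boolP (is_interior S a); last exact: sigma_coeff_out.
have [bint|bint] := boolP (is_interior S b); last first.
  rewrite segmC; apply: sigma_coeff_out bint nbb; rewrite adjacentC; exact: ab.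
have int x : trig a b x \in tris S -> is_interior S x.
  move=> xS; have ax : Defs.adjacent S a x.
    by apply: (@tri_adjacent _ _ S a x b); rewrite tri_swap.
  apply: (region_star_interior aint xS).
  - by rewrite in_trig eqxx.
  - by rewrite in_trig eqxx !orbT.
  - by move=> xb; apply: nl; exists x.
clear nba nbb nl.
have [c [d [cS c0 dS d0]]] := interior_tri aint ab.
have cd : c != d by apply: contraTneq c0 => ->; rewrite -leNgt ltW.
rewrite (sigma_coeff_interior_edge cS dS cd) aint bint (int _ cS) (int _ dS).
have cot x : trig a b x \in tris S ->
    spoke_weight a b x + spoke_weight b a x = 1 / line_dist (pos x) (pos a) (pos b).
  by move=> xS; apply: cot_angleD; rewrite -area_rot; exact: tri_area.
have cancel (x y z w m n : R) : x + y = m -> z + w = n ->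
    - (x + z) - (y + w) + m + n = 0 by move=> <- <-; ring.
exact: cancel (cot _ cS) (cot _ dS).
Qed.

End Interior.

Theorem theorem7 (R : realType) (V : finType) (S : triangulated_structure R V) :
  let sig e := coeff (sigma S) e in
  let p := pos S in
  let int := is_interior S in
  let exceptional (e : {set V}) :=
    touches_boundary S e \/ (forall v, v \in e -> one_link_away S v) in
  [/\ (forall L : {set V} -> R,
         sigma S L = \sum_(e in edges S) sig e * L e),
      (forall e, e \in edges S -> ~ exceptional e -> sig e = 0),
      (forall e, e \in edges S -> exceptional e ->
         sig e = \sum_(v | int v && (radial S v e || circumferential S v e))
                   coeff (wagon_wheel S v) e),
      (* V3 absent *)
      (forall V0 V1 V2 : V,
         trig V0 V2 V1 \in tris S ->
         (forall x, trig V0 V2 x \in tris S -> x = V1) ->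
         let h3 := line_dist (p V1) (p V0) (p V2) in
         [&& int V1, ~~ int V0 & ~~ int V2] -> sig (segm V0 V2) = 1 / h3)
    & (forall V0 V1 V2 V3 : V,
         trig V0 V2 V1 \in tris S -> trig V0 V2 V3 \in tris S -> V1 != V3 ->
         let l := enorm (p V2 - p V0) in
         let alpha1 := angle (p V1) (p V0) (p V2) in
         let alpha2 := angle (p V2) (p V0) (p V3) in
         let beta1 := angle (p V0) (p V2) (p V1) in
         let gamma1 := angle (p V0) (p V2) (p V3) in
         let h1 := l * sin beta1 in
         let h2 := l * sin gamma1 in
         let h5 := l * sin alpha1 in
         let h6 := l * sin alpha2 in
         let h3 := line_dist (p V1) (p V0) (p V2) in
         let h4 := line_dist (p V3) (p V0) (p V2) in
         let s := sig (segm V0 V2) in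
         [/\ [&& ~~ int V0, int V1, ~~ int V2 & ~~ int V3] -> s = 1 / h3,
             [&& int V0, ~~ int V1, ~~ int V2 & ~~ int V3] ->
               s = - (cos beta1 / h1) - cos gamma1 / h2,
             [&& ~~ int V0, int V1, ~~ int V2 & int V3] ->
               s = 1 / h3 + 1 / h4
           & [/\ [&& int V0, int V1, ~~ int V2 & ~~ int V3] ->
               s = cos alpha1 / h5 - cos gamma1 / h2,
             [&& int V0, ~~ int V1, int V2 & ~~ int V3] ->
               s = - (1 / h3) - 1 / h4,
             [&& int V0, int V1, ~~ int V2 & int V3] ->
               s = cos alpha1 / h5 + cos alpha2 / h6
           & [&& int V0, int V1, int V2 & ~~ int V3] ->
               s = - (1 / h4)]])].
Proof.
move=> sig p int exceptional; split.
- exact: sigma_linear.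
- move=> e /[dup] eE; rewrite inE => /andP[/cards2P[a [b [ab e_ab]]] _] nex.
  rewrite -/(segm a b) in e_ab; rewrite {}e_ab in eE nex *.
  have nb v : v \in segm a b -> ~ on_boundary S v.
    by move=> vab vb; apply: nex; left; exists v.
  have na : ~ on_boundary S a by apply: nb; rewrite !inE eqxx.
  have {}nb : ~ on_boundary S b by apply: nb; rewrite !inE eqxx orbT.
  (* [sigma_coeff_deep] needs its first endpoint not to be one link away. If [a] fails, [b]
     qualifies and the edge is reversed. *)
  have [la|la] := pselect (one_link_away S a); last exact: sigma_coeff_deep la.
  rewrite /sig segmC; apply: sigma_coeff_deep nb na _; first by rewrite adjacentC.
  move=> lb; apply: nex; right => v; rewrite !inE => /orP[] /eqP ->.
    exact: la.
  exact: lb.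
- by move=> e _ _; exact: sigma_coeff_near.
- move=> V0 V1 V2 tS only h3 /and3P[i1 n0 n2].
  rewrite /sig sigma_coeffE (bigD1 V1)//= coeff_circumferential//; last by rewrite trigA.
  rewrite big1 => [|v /andP[vint v1]]; first exact: addr0.
  apply: (coeff_no_tri vint).
  + by apply: contraNneq n0 => <-.
  + by apply: contraNneq n2 => <-.
  by apply: contra v1; rewrite trigA => /only ->.
move=> V0 V1 V2 V3 t1 t3 n13 l alpha1 alpha2 beta1 gamma1 h1 h2 h5 h6 h3 h4 s.
have [p02 p01 p21] := tri_pos_neq t1.
have [_ p03 p23] := tri_pos_neq t3.
(* The products of [l] with a sine are distances from an endpoint of the edge to another side, as in
   the wagon wheels. *)
have h1E : h1 = line_dist (p V0) (p V2) (p V1).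
  by rewrite /h1 /l -enormN opprB; apply: enorm_sin_angle; rewrite // eq_sym.
have h2E : h2 = line_dist (p V0) (p V2) (p V3).
  by rewrite /h2 /l -enormN opprB; apply: enorm_sin_angle; rewrite // eq_sym.
have h5E : h5 = line_dist (p V2) (p V0) (p V1).
  by rewrite /h5 /alpha1 angleC; apply: enorm_sin_angle; rewrite eq_sym.
have h6E : h6 = line_dist (p V2) (p V0) (p V3).
  by apply: enorm_sin_angle; rewrite eq_sym.
have cot3 : cos beta1 / h1 + cos alpha1 / h5 = 1 / h3.
  rewrite h1E h5E /alpha1 angleC; apply: cot_angleD.
  by rewrite area_rot area_rot; exact: tri_area.
have cot4 : cos gamma1 / h2 + cos alpha2 / h6 = 1 / h4.
  rewrite h2E h6E; apply: cot_angleD.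
  by rewrite area_rot area_rot; exact: tri_area.
have -> : s = (if int V0 then - (cos beta1 / h1 + cos gamma1 / h2) else 0)
    + (if int V2 then - (cos alpha1 / h5 + cos alpha2 / h6) else 0)
    + (if int V1 then 1 / h3 else 0) + (if int V3 then 1 / h4 else 0).
  rewrite h1E h2E h5E h6E /alpha1 angleC.
  exact: sigma_coeff_interior_edge.
split; [| | |split] => /and4P[].
(* Each case fixes one interiority pattern; writing [1 / h3] and [1 / h4] as cotangent sums leaves
   ring identities. *)
all: case: (int V0); case: (int V1); case: (int V2); case: (int V3) => // _ _ _ _.
all: rewrite -?cot3 -?cot4; ring.
Qed.
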